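(* Let $X$ be a Tychonoff space that is scattered, hereditarily meta-Lindelöf, and locally countable. Then $X$ is $\sigma$-discrete.
   Context: A space is scattered if every nonempty subspace of it has an isolated point. A space is locally countable if every point has a countable neighbourhood. A space is meta-Lindelöf if every open cover has an open refinement (an open cover each of whose members is contained in a member of the given cover) which is point countable (each point lies in only countably many members); it is hereditarily meta-Lindelöf if every subspace is meta-Lindelöf. A space is $\sigma$-discrete if it is the union of countably many subspaces each of which is discrete in its relative topology. *)

(* Defs.v *)
From mathcomp Require Import all_boot.
From mathcomp Require Import all_classical.
From mathcomp Require Import topology separation_axioms subtype_topology urysohn.

Set Implicit Arguments.
Unset Strict Implicit.
Unset Printing Implicit Defensive.

Local Open Scope classical_set_scope.

Section topological_properties.
Variable T : topologicalType.

(* [completely_regular_space] contains no T1 axiom; it separates points from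
   closed sets by a uniformity, which [uniform_separatorP] turns into a
   continuous function to [0, 1]. *)
Definition tychonoff_space : Prop :=
  accessible_space T /\ completely_regular_space T.

Definition scattered_space : Prop :=
  forall A : set T, A !=set0 -> exists x, isolated A x.

(* As everywhere in the library, a neighbourhood need not be open. *)
Definition locally_countable : Prop :=
  forall x : T, exists2 V, nbhs x V & countable V.

Definition open_cover (U : set (set T)) : Prop :=
  U `<=` open /\ cover U id = [set: T].

Definition refines (V U : set (set T)) : Prop :=
  forall W, V W -> exists2 O, U O & W `<=` O.

Definition point_countable (V : set (set T)) : Prop :=
  forall x : T, countable [set W | V W /\ W x].

Definition meta_Lindelof : Prop :=
  forall U, open_cover U ->
    exists V, [/\ open_cover V, refines V U & point_countable V].

(* The property asserted by the mixin of [discreteTopologicalType]. *)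
Definition discrete_space : Prop := @nbhs T T = @principal_filter T.

End topological_properties.

(* Subsets are coerced to the types [set_type A], which carry the relative
   topology; [subspace A] would not do, since its carrier is all of [T], with
   the points outside [A] made isolated. *)
Definition hereditarily_meta_Lindelof (T : topologicalType) : Prop :=
  forall A : set T, meta_Lindelof A.

(* The [D n] may be empty or repeated, so finite unions are included. *)
Definition sigma_discrete (T : topologicalType) : Prop :=
  exists D : nat -> set T,
    \bigcup_n D n = [set: T] /\ forall n, discrete_space (D n).

(* Main.v *)
Require Import Defs.
From mathcomp Require Import all_boot all_classical topology.
From Stdlib Require Import Relations.

(** Local countability and the meta-Lindelöf property give a point-countable
    cover by countable open sets.  Each of its members meets only countably many
    others, so the classes of points linked by finite chains of members are
    countable; they are also open and partition the space.  Enumerating every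
    class and collecting the n-th points of all classes gives the n-th discrete
    subspace. *)

Set Implicit Arguments.
Unset Strict Implicit.
Unset Printing Implicit Defensive.

Local Open Scope classical_set_scope.

Definition adjacent (T : Type) (V : set (set T)) (x y : T) : Prop :=
  exists W, [/\ V W, W x & W y].

Definition chain_component (T : Type) (V : set (set T)) (x : T) : set T :=
  clos_refl_sym_trans T (adjacent V) x.

Lemma chain_component_refl T (V : set (set T)) x : chain_component V x x.
Proof. exact: rst_refl. Qed.

Lemma chain_component_eq T (V : set (set T)) x y :
  chain_component V x y -> chain_component V y = chain_component V x.
Proof.
move=> xy; apply/seteqP; split=> z; first exact: rst_trans.
by apply: rst_trans; exact: rst_sym.
Qed.

Lemma adjacent_sym T (V : set (set T)) x y : adjacent V x y -> adjacent V y x.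
Proof. by case=> W [VW Wx Wy]; exists W. Qed.

(** A point lies in countably many members, each countable, so [star] preserves countability;
    finitely many links stay within the iterates of [star] on the singleton of [x]. *)
Lemma chain_component_countable (T : topologicalType) (V : set (set T)) x :
  point_countable V -> (forall W, V W -> countable W) ->
  countable (chain_component V x).
Proof.
move=> pcV cV.
pose star (A : set T) := \bigcup_(a in A) [set y | adjacent V a y].
have star_countable A : countable A -> countable (star A).
  move=> cA; apply: bigcup_countable => // a _.
  suff -> : [set y | adjacent V a y] = \bigcup_(W in [set W | V W /\ W a]) W.
    by apply: bigcup_countable (pcV a) _ => W [/cV].
  by apply/seteqP; split=> [y [W [VW Wa Wy]]|y [W [VW Wa] Wy]]; exists W.
have : countable (\bigcup_n iter n star [set x]).
  apply: bigcup_countable => // n _.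
  by elim: n => [|n IHn]; [exact: countable1|exact: star_countable].
apply/sub_countable/subset_card_le => y xy.
(* Chains are rebuilt by adding one link, of either orientation, at the far end; this matches one
   more application of [star]. *)
elim: (clos_rst_rstn1 _ _ _ _ xy) => {y xy} [|y z yz _ [n _ ny]].
  by exists 0.
exists n.+1 => //; exists y => //=.
by case: yz => // zy; exact: adjacent_sym.
Qed.

Lemma chain_component_open (T : topologicalType) (V : set (set T)) x :
  open_cover V -> open (chain_component V x).
Proof.
case=> oV cV; rewrite openE => y xy.
have [W VW Wy] : cover V id y by rewrite cV.
apply: filterS (open_nbhs_nbhs (conj (oV _ VW) Wy)) => z Wz.
by apply: (rst_trans _ _ _ _ _ xy); apply: rst_step; exists W.
Qed.

(** The subtype of [[set: T]] is a different type from [T], but [set_val] is a homeomorphism: covers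
    are pulled back along it and refinements returned along its inverse [toT]. *)
Lemma meta_Lindelof_setT (T : topologicalType) :
  meta_Lindelof [set: T] -> meta_Lindelof T.
Proof.
move=> mL U [oU cU].
pose pre (O : set T) : set [set: T] := set_val @^-1` O.
have [|V [[oV cV] rV pV]] := mL (pre @` U).
  split=> [_ [O UO <-]|]; first by exists O => //; exact: oU.
  rewrite -subTset => x _.
  have [O UO Ox] : cover U id (set_val x) by rewrite cU.
  by exists (pre O) => //; exists O.
pose toT (x : T) : [set: T] := exist _ x (in_setT x).
have toTK (x : [set: T]) : toT (set_val x) = x by exact: val_inj.
exists [set toT @^-1` W | W in V]; split.
(* A relatively open [W] is the trace of an open [B], and its preimage under [toT] is [B] by
   computation. *)
- split=> [_ [W /oV[B oB <-] <-]|] //.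
  rewrite -subTset => x _.
  have [W VW Wx] : cover V id (toT x) by rewrite cV.
  by exists (toT @^-1` W) => //; exists W.
- move=> _ [W VW <-]; have [_ [O UO <-] WO] := rV _ VW.
  by exists O => // x /WO.
- move=> x; apply: sub_countable (pV (toT x)).
  apply: (card_le_trans (subset_card_le _) (card_image_le (preimage toT) _)).
  by move=> _ [[W VW <-] Wx]; exists W.
Qed.

(** The trace of [C] on [D] is a relatively open singleton, which makes the neighbourhood filter at
    [x] principal. *)
Lemma discrete_subset (T : topologicalType) (D : set T) :
  (forall x, D x -> exists2 C, open_nbhs x C & D `&` C `<=` [set x]) ->
  discrete_space D.
Proof.
move=> isoD; apply/funext => x; apply/seteqP; split=> A.
  by move=> /nbhs_singleton Ax; exact/principal_filterP.
move=> /principal_filterP Ax.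
have [C [oC Cx] DC] := isoD _ (set_mem (valP x)).
rewrite nbhsE; exists (set_val @^-1` C); first by split=> //; exists C.
move=> y Cy; suff -> : y = x by [].
by apply/val_inj/DC; split=> //; exact: set_mem (valP y).
Qed.

Lemma sigma_discrete_of_meta_Lindelof (T : topologicalType) :
  meta_Lindelof T -> locally_countable T -> sigma_discrete T.
Proof.
move=> mL lc.
have [|V [oV rV pV]] := mL [set O | open O /\ countable O].
  split=> [O []//|]; rewrite -subTset => x _.
  have [N Nx cN] := lc x; exists (interior N) => //; split.
    exact: open_interior.
  exact: sub_countable (subset_card_le (@interior_subset _ N)) cN.
have cV W : V W -> countable W.
  move=> /rV[O [_ cO] WO]; exact: sub_countable (subset_card_le WO) cO.
(* The enumeration depends on the set alone, so all points of a class share it; the constant 0 is a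
   dummy value for uncountable sets. *)
have /choice[f finj] (A : set T) :
    exists g : T -> nat, countable A -> {in A &, injective g}.
  have [/countable_injP[g ginj]|nA] := pselect (countable A).
    by exists g.
  by exists (fun=> 0) => /nA.
pose C := chain_component V.
exists (fun n => [set x | f (C x) x = n]); split.
  by rewrite -subTset => x _; exists (f (C x) x).
move=> n; apply: discrete_subset => x /= fx; exists (C x).
  by split; [exact: chain_component_open|exact: chain_component_refl].
(* As [y] lies in the class of [x], both indices are values of the same injection, and their
   equality forces [y = x]. *)
move=> y [/= + Cxy]; rewrite /C (chain_component_eq Cxy) -/C -fx.
apply: finj; rewrite ?inE //; last exact: chain_component_refl.
exact: chain_component_countable.
Qed.

Theorem theorem3p5 (X : topologicalType) :
  tychonoff_space X -> scattered_space X -> hereditarily_meta_Lindelof X ->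
  locally_countable X -> sigma_discrete X.
Proof.
move=> _ _ hmL; apply: sigma_discrete_of_meta_Lindelof.
exact: meta_Lindelof_setT.
Qed.
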